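(* For every real number field $K$, the equality $E_K=D_K$ holds, where $D_K$ is the set of positive differences of two Pisot numbers generating $K$, and $E_K$ is the set of positive algebraic integers $\beta$ of $K$ such that $|\sigma_j(\beta)|<2$ for all $j\in\{2,\dots,d\}$ (see the context for the precise definitions).
   Context: A real number field $K$ is a subfield of $\mathbb{R}$ of finite degree $d$ over $\mathbb{Q}$ ($d=1$, i.e. $K=\mathbb{Q}$, is allowed). Its distinct embeddings into $\mathbb{C}$ are $\sigma_1,\dots,\sigma_d$, where $\sigma_1$ is the identity (inclusion) of $K$. $\mathbb{Z}_K$ denotes the ring of integers of $K$. A Pisot number is a real algebraic integer greater than $1$ whose other conjugates over $\mathbb{Q}$ are all of modulus less than $1$ (so every rational integer $\ge 2$ is a Pisot number); $S$ is the set of Pisot numbers. Define $$\wp_K:=\{\theta : \theta\in S\cap K \text{ and } K=\mathbb{Q}(\theta)\}.$$ Let $\theta_1<\theta_2<\theta_3<\cdots$ denote the elements of $\wp_K$ in increasing order ($\wp_K$ is an infinite discrete subset of $[1,\infty)$). Define $$D_K:=\{\theta_n-\theta_m : (n,m)\in\mathbb{N}^2,\ n>m\}=(\wp_K-\wp_K)\cap(0,\infty),$$ $$E_K:=\{\beta\in\mathbb{Z}_K\cap(0,\infty) : |\sigma_2(\beta)|<2,\dots,|\sigma_d(\beta)|<2\},$$ where $\mathbb{N}$ denotes the positive integers. When $d=1$ the conditions defining $E_K$ on $\sigma_2,\dots,\sigma_d$ are vacuous. *)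

(* Defs.v *)
From HB Require Import structures.
From mathcomp Require Import all_boot all_order all_algebra all_field.
From mathcomp Require Import boolp classical_sets reals.
From mathcomp Require Import complex.

Set Implicit Arguments.
Unset Strict Implicit.
Unset Printing Implicit Defensive.

Import Order.TTheory GRing.Theory Num.Theory.
Local Open Scope classical_set_scope.
Local Open Scope ring_scope.
Local Open Scope complex_scope.

(* The minimal polynomial of [x] over the rationals is the monic irreducible
   polynomial vanishing at [x]; the conjugates of [x] are its complex roots. *)
Definition conjugate_over_rat (R : realType) (x : R) (z : R[i]) : Prop :=
  exists p : {poly rat},
    [/\ p \is monic, irreducible_poly p,
        root (map_poly (@ratr R) p) x
      & root (map_poly (@ratr R[i]) p) z].

Definition pisot (R : realType) (x : R) : Prop :=
  [/\ integralOver (intr : int -> R) x, 1 < x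
    & forall z : R[i], conjugate_over_rat x z -> z != x%:C -> `|z| < 1].

(* Below, a real number field is a finite extension [K] of the rationals
   together with a field morphism [iota] to the reals: the subfield of [R] in
   question is the range of [iota], and [iota] is its inclusion.  All the sets
   are sets of real numbers. *)

Definition ring_of_integers (K : fieldExtType rat) : set K :=
  [set x | integralOver (intr : int -> K) x].

Definition pisot_generators (R : realType) (K : fieldExtType rat)
    (iota : {rmorphism K -> R}) : set R :=
  [set iota t | t in [set t : K | pisot (iota t) /\ <<1; t>>%VS = {:K}%VS]].

Definition pisot_differences (R : realType) (K : fieldExtType rat)
    (iota : {rmorphism K -> R}) : set R :=
  [set b | 0 < b /\
    exists x y : R,
      [/\ pisot_generators iota x, pisot_generators iota y & b = x - y]].

(* The index [sigma] ranges over the embeddings of [K] into the complex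
   numbers other than the inclusion. *)
Definition small_conjugate_integers (R : realType) (K : fieldExtType rat)
    (iota : {rmorphism K -> R}) : set R :=
  [set iota b | b in [set b : K |
    [/\ ring_of_integers b, 0 < iota b
      & forall sigma : {rmorphism K -> R[i]},
          ~ (sigma =1 fun x => (iota x)%:C) -> `|sigma b| < 2]]].

(* Main.v *)
From HB Require Import structures.
Require Import Defs.
From mathcomp Require Import all_boot all_order all_algebra all_field.
From mathcomp Require Import boolp classical_sets reals.
From mathcomp Require Import complex ring lra.

(* If [x] and [y] are Pisot generators, every other embedding maps them into the
   open unit disc, hence their difference into the disc of radius 2.  Conversely,
   for an integer [b] whose other conjugates have modulus less than 2, it suffices
   to find an algebraic integer [y] of [K] with [y > 1] whose other conjugates are
   close to those of [- b / 2]: then [y] and [y + b] both have their other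
   conjugates in the open unit disc, and such integers are Pisot generators.  With
   [alpha] an integral generator of [K], [y] is found in [Z[alpha]] by Dirichlet's
   simultaneous approximation theorem, the other conjugates of [f(alpha)] being
   controlled by the remainder of [f] modulo [p / (X - alpha)], for [p] the minimal
   polynomial of [alpha]. *)

Set Implicit Arguments.
Unset Strict Implicit.
Unset Printing Implicit Defensive.

Import Order.TTheory GRing.Theory Num.Theory.
Local Open Scope ring_scope.
Local Open Scope complex_scope.

(** * Dirichlet approximation, evaluation bounds and separability *)

(** Pigeonhole: the fractional parts of the multiples of [w] by 0, ..., [M ^ n] fall into [M ^ n]
    cells of side 1/[M]. Two multiples share a cell, and their difference is the required one. *)
Lemma simultaneous_approximation (R : archiRealFieldType) (n : nat)
    (w : 'I_n -> R) (M : nat) : (0 < M)%N ->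
  exists (k : nat) (c : 'I_n -> int),
    (0 < k)%N /\ forall i, `|k%:R * w i - (c i)%:~R| <= M%:R^-1.
Proof.
case: M => // M _.
pose fr (k : nat) i := k%:R * w i - (Num.floor (k%:R * w i))%:~R.
have fr_ge0 k i : 0 <= fr k i by rewrite subr_ge0 floor_le.
have fr_lt1 k i : fr k i < 1.
  by have := floorD1_gt (k%:R * w i); rewrite /fr intrD; lra.
have M_gt0 : 0 < M.+1%:R :> R by rewrite ltr0n.
have Mfr_ge0 k i : 0 <= M.+1%:R * fr k i by rewrite mulr_ge0 // ltW.
have cell_lt k i : (Num.trunc (M.+1%:R * fr k i) < M.+1)%N.
  rewrite -(ltr_nat R); apply: (@le_lt_trans _ _ (M.+1%:R * fr k i)).
    by case/andP: (truncn_itv (Mfr_ge0 k i)).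
  by rewrite -[ltRHS]mulr1 ltr_pM2l.
pose cell (k : 'I_(M.+1 ^ n).+1) := [ffun i => Ordinal (cell_lt k i)].
have /injectivePn [k1 [k2 neq12 eq12]] : ~~ injectiveb cell.
  apply/negP => /injectiveP /leq_card.
  by rewrite card_ffun !card_ord ltnn.
wlog lt12 : k1 k2 neq12 eq12 / (k1 < k2)%N.
  move=> th; have := neq12; rewrite -val_eqE neq_ltn => /orP [lt12|lt21].
    exact: (th k1 k2).
  by apply: (th k2 k1); rewrite // eq_sym.
exists (k2 - k1)%N, (fun i => Num.floor (k2%:R * w i) - Num.floor (k1%:R * w i)).
split=> [|i]; first by rewrite subn_gt0.
have -> : (k2 - k1)%:R * w i -
    (Num.floor (k2%:R * w i) - Num.floor (k1%:R * w i))%:~R = fr k2 i - fr k1 i.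
  by rewrite /fr natrB ?(ltnW lt12) // intrB; ring.
have /(congr1 val) /= eqi : cell k1 i = cell k2 i by rewrite eq12.
rewrite !ffunE /= in eqi.
rewrite -(ler_pM2l M_gt0) divff ?gt_eqF // -[X in X * _](gtr0_norm M_gt0).
rewrite -normrM mulrBr ler_norml.
have := truncn_itv (Mfr_ge0 k1 i); have := truncn_itv (Mfr_ge0 k2 i).
rewrite eqi -natr1 => /andP [] ? ? /andP [] ? ?.
lra.
Qed.

Lemma normc_real (R : rcfType) (x : R) : `|x%:C| = `|x|%:C.
Proof. by rewrite normc_def /= expr0n addr0 sqrtr_sqr. Qed.

(** Each value is at most [e] times the sum of the powers of |z|. Summing over the finite list makes
    the constant uniform, and the added 1 keeps it positive. *)
Lemma horner_bound (R : rcfType) (rs : seq R[i]) (n : nat) :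
  exists2 C : R, 0 < C & forall (z : R[i]) (r : {poly R}) (e : R), z \in rs ->
    (size r <= n)%N -> (forall i, `|r`_i| <= e) ->
    `|(map_poly (real_complex R) r).[z]| <= (e * C)%:C.
Proof.
pose c (z : R[i]) := \sum_(i < n) (Normc.normc z) ^+ i.
have c_ge0 z : 0 <= c z.
  apply: sumr_ge0 => i _; apply: exprn_ge0.
  by rewrite -lecR; apply: (normr_ge0 z).
exists (1 + \sum_(z <- rs) c z) => [|z r e zrs szr re].
  by rewrite ltr_pwDl // sumr_ge0.
have e_ge0 : 0 <= e := le_trans (normr_ge0 _) (re 0).
apply: (@le_trans _ _ (e * c z)%:C); last first.
  rewrite lecR ler_wpM2l // (big_rem z) //= addrCA lerDl addr_ge0 //.
  by rewrite sumr_ge0.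
rewrite (@horner_coef_wide _ n); last by rewrite size_map_poly.
apply: le_trans (ler_norm_sum _ _ _) _.
rewrite rmorphM rmorph_sum mulr_sumr /=; apply: ler_sum => i _.
rewrite normrM normrX coef_map  rmorphXn /=.
have -> : (Normc.normc z)%:C = `|z| by [].
apply: ler_wpM2r; first by rewrite exprn_ge0.
by rewrite normc_real lecR.
Qed.

Lemma map_poly_intC (R : rcfType) (f : {poly int}) :
  map_poly (intr : int -> R[i]) f =
  map_poly (real_complex R) (map_poly intr f).
Proof. by rewrite -map_poly_comp; apply: eq_map_poly => x; rewrite /= rmorph_int. Qed.

Lemma map_poly_ratC (R : rcfType) (f : {poly rat}) :
  map_poly (@ratr R[i]) f = map_poly (real_complex R) (map_poly (@ratr R) f).
Proof. by rewrite -map_poly_comp; apply: eq_map_poly => x; rewrite /= fmorph_rat. Qed.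

(** In characteristic 0 the derivative is nonzero and of smaller degree, so [p] cannot divide it. *)
Lemma irreducible_poly_separable (p : {poly rat}) :
  irreducible_poly p -> separable_poly p.
Proof.
move=> irr_p; have p_gt1 := irr_p.1.
have szp' : size p^`() = (size p).-1 by exact: polyorder.size_deriv.
rewrite unlock irreducible_poly_coprime //.
apply/negP => /dvdp_leq; rewrite -size_poly_eq0 szp' -lt0n.
by case: (size p) p_gt1 => [|[|n]] // _ => /(_ isT); rewrite ltnn.
Qed.

(** * Integer polynomials with prescribed approximate values at the other conjugates *)

Section Approximation.
Variables (R : realType) (p : {poly rat}) (alpha : R).
Hypotheses (p_monic : p \is monic) (p_irr : irreducible_poly p).
Hypothesis (p_alpha : root (map_poly ratr p) alpha).

(* Factor [p = ('X - alpha) * q] over [R], with [q] monic of degree [n].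
   Dirichlet's theorem applied to the coefficients of [T q] gives an integer
   polynomial [f = k T q + r] with [r] tiny: at the other roots of [p], [f] takes
   the value of [r], whereas at [alpha] the term [k T q alpha] dominates, because
   [alpha] is a simple root. *)
Lemma exists_small_conjugates (e B : R) : 0 < e -> exists f : {poly int},
  [/\ (size f < size p)%N, f != 0, B < (map_poly intr f).[alpha]
    & forall z : R[i], root (map_poly ratr p) z -> z != alpha%:C ->
        `|(map_poly intr f).[z]| <= e%:C].
Proof.
move=> e_gt0.
(* A positive [B] forces [f] to be nonzero. *)
wlog B_gt0 : B / 0 < B.
  move=> th; have [|f [f1 f2 f3 f4]] := th (`|B| + 1); first by rewrite ltr_wpDl.
  exists f; split => //; apply: le_lt_trans f3.
  by rewrite (le_trans (ler_norm _)) // lerDl.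
have [q pq] := factor_theorem _ _ p_alpha.
have q_monic : q \is monic.
  by rewrite -(monicMr _ (monicXsubC alpha)) -pq map_monic.
have [n szq] : exists n, size q = n.+1.
  by exists (size q).-1; rewrite prednK // size_poly_gt0 monic_neq0.
have szp : size p = n.+2.
  by rewrite -(size_map_poly (@ratr R)) pq size_Mmonic ?monicXsubC ?monic_neq0
     // size_XsubC szq addn2.
have qn : q`_n = 1 by move/monicP: q_monic; rewrite lead_coefE szq.
have q_alpha : q.[alpha] != 0.
  have := irreducible_poly_separable p_irr.
  by rewrite -(separable_map (@ratr R)) pq separable_root => /andP [].
have [rs prs] := closed_field_poly_normal (map_poly (@ratr R[i]) p).
have [C C_gt0 bnd] := horner_bound (alpha%:C :: rs) n.+1.
(* As [k >= 1], this makes |k T q(alpha)| exceed [B + e], where [e] absorbs the remainder at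
   [alpha]. *)
pose T := (Num.trunc ((B + e) / `|q.[alpha]|)).+1.
have TP : B + e < T%:R * `|q.[alpha]|.
  by rewrite -ltr_pdivrMr ?normr_gt0 // truncnS_gt.
pose M := (Num.trunc (C / e)).+1.
have MP : M%:R^-1 * C <= e.
  have : C / e < M%:R by rewrite truncnS_gt.
  have M_gt0 : 0 < M%:R :> R by rewrite ltr0n.
  by rewrite ltr_pdivrMr // [M%:R^-1 * C]mulrC ler_pdivrMr // mulrC => /ltW.
have [//|k [c [k_gt0 kc]]] :=
  @simultaneous_approximation R n (fun i => - (T%:R * q`_i)) M.
(* [c] approximates the lower coefficients of [- k T q], hence the minus sign; the top one is exact
   since [q] is monic. The default 0 is never reached, as [j < n]. *)
pose f : {poly int} := (k * T)%:Z *: 'X^n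
   - \poly_(j < n) (if insub j is Some i then c i else 0).
pose r := map_poly intr f - (k * T)%:R *: q.
have r_coef i : `|r`_i| <= M%:R^-1.
  rewrite /r coefB coef_map /= coefB !coefZ coefXn coef_poly.
  case: (ltngtP i n) => [lt_in|gt_in|->].
  - rewrite insubT /= mulr0 sub0r.
    apply: le_trans (kc (Ordinal lt_in)); rewrite /= natrM rmorphN /=.
    by rewrite le_eqVlt; apply/orP; left; apply/eqP; congr (`| _ |); ring.
  - by rewrite nth_default ?szq // !mulr0 !subr0 mulr0z normr0 invr_ge0.
  - by rewrite qn subr0 !mulr1 -pmulrn subrr normr0 invr_ge0.
have fE : map_poly intr f = (k * T)%:R *: q + r by rewrite /r addrCA subrr addr0.
have szf : (size f <= n.+1)%N.
  apply/leq_sizeP => j ltnj; rewrite coefB coefZ coefXn coef_poly.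
  by rewrite gtn_eqF // ltnNge (ltnW ltnj) mulr0 subrr.
have szr : (size r <= n.+1)%N.
  rewrite (leq_trans (size_polyD _ _)) // geq_max size_polyN.
  rewrite (leq_trans (size_poly _ _)) //=.
  by rewrite (leq_trans (size_scale_leq _ _)) ?szq.
have r_small z : z \in alpha%:C :: rs ->
    `|(map_poly (real_complex R) r).[z]| <= e%:C.
  move=> zrs; apply: le_trans (bnd _ _ _ zrs szr r_coef) _.
  by rewrite lecR.
have f_small z : root (map_poly ratr p) z -> z != alpha%:C ->
    `|(map_poly intr f).[z]| <= e%:C.
  move=> pz z_neq; have zrs : z \in alpha%:C :: rs.
    move: (pz); rewrite prs rootZ ?root_prod_XsubC; first by rewrite inE orbC => ->.
    by rewrite lead_coef_eq0 map_poly_eq0 monic_neq0.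
  have qz : (map_poly (real_complex R) q).[z] = 0.
    move: pz; rewrite map_poly_ratC pq rmorphM /= rootM => /orP [/rootP //|].
    by rewrite map_polyXsubC root_XsubC (negPf z_neq).
  rewrite map_poly_intC fE rmorphD /= map_polyZ hornerD hornerZ qz mulr0 add0r.
  exact: r_small.
have f_big : B < `|(map_poly intr f).[alpha]|.
  have r_alpha : `|r.[alpha]| <= e.
    have := r_small _ (mem_head _ _).
    by rewrite horner_map normc_real lecR.
  rewrite fE hornerD hornerZ.
  have : T%:R * `|q.[alpha]| <= `|(k * T)%:R * q.[alpha]|.
    by rewrite normrM normr_nat ler_pM2r ?normr_gt0 // ler_nat leq_pmull.
  have := lerB_normD ((k * T)%:R * q.[alpha]) r.[alpha].
  lra.
have f_neq0 : f != 0.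
  by apply: contraTneq f_big => ->; rewrite rmorph0 horner0 normr0 -leNgt ltW.
have [fge0|flt0] := leP 0 (map_poly (intr : int -> R) f).[alpha].
  by exists f; split; rewrite ?szp // -(ger0_norm fge0).
exists (- f); split; rewrite ?szp ?size_polyN ?oppr_eq0 //.
  by rewrite rmorphN hornerN -(ltr0_norm flt0).
by move=> z pz z_neq; rewrite rmorphN hornerN normrN; apply: f_small.
Qed.

(* With [f] small at the other roots and [a * f = g] modulo [p], rounding the
   coefficients of [a] changes the values of [a * f] there only slightly.  A second
   polynomial with small conjugates then makes the value at [alpha] large. *)
Lemma integer_poly_approximation (g : {poly rat}) (e B : R) : 0 < e ->
  exists h : {poly int}, B < (map_poly intr h).[alpha] /\
    forall z : R[i], root (map_poly ratr p) z -> z != alpha%:C ->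
      `|(map_poly intr h).[z] - (map_poly ratr g).[z]| <= e%:C.
Proof.
move=> e_gt0.
have [rs prs] := closed_field_poly_normal (map_poly (@ratr R[i]) p).
have [C C_gt0 bnd] := horner_bound rs (size p).
have e2_gt0 : 0 < e / 2 by rewrite divr_gt0.
(* Rounding [a] moves its coefficients by at most 1, hence its values at the roots by at most [C];
   multiplying by [f] brings this down to [e / 2]. The other half is for [f2]. *)
have [|f [szf f_neq0 _ f_small]] := @exists_small_conjugates (e / 2 / C) 0.
  by rewrite divr_gt0.
pose fQ : {poly rat} := map_poly intr f.
have fQ_coprime : coprimep fQ p.
  rewrite coprimep_sym irreducible_poly_coprime //; apply/negP => /dvdp_leq.
  have szfQ : size fQ = size f by rewrite size_map_inj_poly //; apply: intr_inj.
  by rewrite -size_poly_eq0 szfQ size_poly_eq0 leqNgt szf => /(_ f_neq0).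
have /Bezout_eq1_coprimepP [[u v] /= uv] := fQ_coprime.
(* By Bezout, [a * fQ] is congruent to [g] modulo [p]; reducing bounds the size of [a], as the
   choice of [C] requires. *)
pose a := (g * u) %% p.
have aP : g - a * fQ = p * (g * v + (g * u) %/ p * fQ).
  have aE : a = g * u - (g * u) %/ p * p.
    by rewrite [X in X - _](divp_eq _ p) addrC addKr.
  by rewrite [in LHS]aE -[X in X - _ = _]mulr1 -uv; ring.
have sza : (size a < size p)%N by rewrite ltn_modp monic_neq0.
pose a' := \poly_(i < size p) Num.floor a`_i.
pose r : {poly R} := map_poly ratr (a - map_poly intr a').
have [f2 [_ _ f2_big f2_small]] := @exists_small_conjugates (e / 2)
  (B - (map_poly intr (a' * f)).[alpha]) e2_gt0.
exists (a' * f + f2); split; first by rewrite rmorphD hornerD; lra.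
move=> z pz z_neq.
have zrs : z \in rs.
  move: pz; rewrite prs rootZ ?root_prod_XsubC //.
  by rewrite lead_coef_eq0 map_poly_eq0 monic_neq0.
have r_small : `|(map_poly (real_complex R) r).[z]| <= C%:C.
  rewrite -[C]mul1r; apply: bnd => // [|i].
    rewrite size_map_poly (leq_trans (size_polyD _ _)) // geq_max size_polyN.
    by rewrite (ltnW sza) (leq_trans (size_poly _ _)) // size_poly.
  rewrite coef_map /= coefB coef_map coef_poly /=.
  have [lt_ip|le_pi] := ltnP i (size p); last first.
    by rewrite nth_default ?subr0 ?rmorph0 ?normr0 // (leq_trans (ltnW sza)).
  have -> : 1 = ratr 1 :> R by rewrite rmorph1.
  rewrite -ratr_norm ler_rat ler_norml.
  have /andP [] := floor_itv a`_i; rewrite intrD.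
  by move: (a`_i) (Num.floor _)%:~R => x y ? ?; apply/andP; split; lra.
have -> : (map_poly intr (a' * f + f2)).[z] - (map_poly ratr g).[z] =
    (map_poly intr f2).[z] - (map_poly (real_complex R) r).[z] * (map_poly intr f).[z].
  have /(congr1 (fun s => (map_poly (@ratr R[i]) s).[z])) := aP.
  rewrite [in RHS]rmorphM /= hornerM (rootP pz) mul0r.
  rewrite /r -map_poly_ratC !rmorphB !rmorphD !rmorphM /= !hornerE /fQ.
  have intz (s : {poly int}) : map_poly (@ratr R[i]) (map_poly intr s) = map_poly intr s.
    by rewrite -map_poly_comp; apply: eq_map_poly => x; rewrite /= ratr_int.
  rewrite !intz.
  move: (map_poly ratr g).[z] (map_poly ratr a).[z] (map_poly intr a').[z]
    (map_poly intr f).[z] (map_poly intr f2).[z] => G A A' F F2 /eqP.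
  rewrite subr_eq0 => /eqP ->; ring.
apply: le_trans (ler_normB _ _) _.
have -> : e%:C = (e / 2)%:C + C%:C * (e / 2 / C)%:C.
  rewrite -rmorphM -rmorphD /=; congr (_%:C); field.
  by rewrite gt_eqF.
apply: lerD; first exact: f2_small.
by rewrite normrM ler_pM ?normr_ge0 //; apply: f_small.
Qed.
End Approximation.

(** * Minimal polynomials, integral generators and embeddings of an extension of the rationals *)

(** Otherwise [p] and [s] are coprime, which persists over [L] and excludes a common root. *)
Lemma irreducible_dvdp_root (F L : fieldType) (phi : {rmorphism F -> L})
    (p s : {poly F}) (x : L) : irreducible_poly p ->
  root (map_poly phi p) x -> root (map_poly phi s) x -> p %| s.
Proof.
move=> p_irr px sx; apply: contraLR sx.
rewrite -irreducible_poly_coprime // -(coprimep_map phi) => cop.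
exact: (coprimep_root cop px).
Qed.

Section RationalExtension.
Variable K : fieldExtType rat.
Implicit Types (t x y : K) (q : {poly rat}).

Lemma fmorph_horner_alg (F : fieldType) (phi : {rmorphism K -> F}) q t :
  phi (map_poly (in_alg K) q).[t] = (map_poly ratr q).[phi t].
Proof.
rewrite -horner_map -map_poly_comp; congr _.[_]; apply: eq_map_poly => a.
exact: (fmorph_eq_rat (phi \o in_alg K)).
Qed.

Lemma exists_rat_minPoly t : exists p : {poly rat},
  [/\ p \is monic, irreducible_poly p & root (map_poly (in_alg K) p) t].
Proof.
have /polyOver1P [p pE] := minPolyOver 1%AS t.
exists p; split; last by rewrite -pE root_minPoly.
  by rewrite -(map_monic (in_alg K)) -pE monic_minPoly.
split; first by rewrite -(size_map_poly (in_alg K)) -pE size_minPoly ltnS.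
move=> q q_neq1 qp; rewrite -(eqp_map (in_alg K)) -pE.
have : map_poly (in_alg K) q %| minPoly 1 t by rewrite pE dvdp_map.
have qO : map_poly (in_alg K) q \is a polyOver 1%AS.
  by apply/polyOver1P; exists q.
move/(minPoly_irr qO) => /orP [//|].
by rewrite -size_poly_eq1 size_map_poly (negPf q_neq1).
Qed.

Lemma generator_horner t : <<1; t>>%VS = {:K}%VS ->
  forall x, exists q, x = (map_poly (in_alg K) q).[t].
Proof.
move=> gen_t x; have : x \in <<1; t>>%VS by rewrite gen_t memvf.
by case/Fadjoin_polyP => s /polyOver1P [q ->] ->; exists q.
Qed.

(** With n + 1 the degree of [q], multiplying q(t) = 0 by c^n gives a monic integer relation for c
    t. *)
Lemma integral_scaled_root (c : int) (q : {poly int}) t : c = lead_coef q ->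
  (1 < size q)%N -> (map_poly intr q).[t] = 0 ->
  integralOver (intr : int -> K) (c%:~R * t).
Proof.
move=> cE q_gt1 qt; pose n := (size q).-2.
have szq : size q = n.+2 by rewrite /n; case: (size q) q_gt1 => [|[]].
pose r : {poly int} := \poly_(i < n.+1) (q`_i * c ^+ (n - i)).
exists ('X^(n.+1) + r).
  by rewrite monicE lead_coefDl ?lead_coefXn // size_polyXn ltnS size_poly.
apply/rootP; rewrite rmorphD /= map_polyXn hornerD hornerXn.
have -> : 0 = c%:~R ^+ n * (map_poly intr q).[t] by rewrite qt mulr0.
rewrite (@horner_coef_wide _ n.+1) ?(leq_trans (size_poly _ _)) ?size_poly //.
rewrite (@horner_coef_wide _ n.+2) ?(leq_trans (size_poly _ _)) ?szq //.
rewrite [in RHS]big_ord_recr /= mulrDr addrC; congr (_ + _).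
  rewrite mulr_sumr; apply: eq_bigr => i _.
  rewrite !coef_map coef_poly ltn_ord /= rmorphM rmorphXn /= exprMn.
  have -> : c%:~R ^+ n = c%:~R ^+ (n - i) * c%:~R ^+ i :> K.
    by rewrite -exprD subnK // -ltnS.
  by ring.
by rewrite coef_map /= cE lead_coefE szq /= exprMn exprS; ring.
Qed.

(** A primitive element exists by separability; scaling it by the leading coefficient of an integer
    multiple of its minimal polynomial makes it integral and still generating. *)
Lemma exists_integral_generator :
  exists2 t, integralOver (intr : int -> K) t & <<1; t>>%VS = {:K}%VS.
Proof.
pose t0 := separable_generator 1%AS {:K}%AS.
have gen0 : {:K}%VS = <<1; t0>>%VS.
  apply: eq_adjoin_separable_generator; last exact: sub1v.
  apply/separableP => y _; apply: pcharf0_separable => i.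
  by rewrite (pchar_lalg K) pchar_num.
have [p [p_monic p_irr pt0]] := exists_rat_minPoly t0.
have [q [a a_neq0 pE]] := rat_poly_scale p.
pose c := lead_coef q.
have a_neq0Q : (a%:~R : rat) != 0 by rewrite intr_eq0.
have szq : size p = size q.
  by rewrite pE size_scale ?invr_eq0 // size_map_inj_poly //; apply: intr_inj.
have c_neq0 : c != 0.
  by rewrite lead_coef_eq0 -size_poly_eq0 -szq size_poly_eq0 monic_neq0.
have qt0 : (map_poly intr q).[t0] = 0.
  move/rootP: pt0; rewrite pE map_polyZ hornerZ -map_poly_comp => /eqP.
  rewrite mulf_eq0 fmorph_eq0 invr_eq0 (negPf a_neq0Q) /= => /eqP <-.
  by congr _.[_]; apply: eq_map_poly => x; rewrite -(rmorph_int (in_alg K)).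
exists (c%:~R * t0).
  by apply: (@integral_scaled_root c q); rewrite -?szq //; case: p_irr.
apply/eqP; rewrite eqEsubv subvf gen0.
apply/FadjoinP; split; first exact: subv_adjoin.
have t0E : t0 = (c%:~R : rat)^-1 *: (c%:~R * t0).
  rewrite -(rmorph_int (in_alg K)) /= mulr_algl scalerA.
  by rewrite mulVf ?scale1r // intr_eq0.
by rewrite [X in X \in _]t0E; apply: memvZ; apply: memv_adjoin.
Qed.

(** Choose a polynomial [P x] with value [x] at [t] and send [x] to its value at [z]. Two choices
    differ by a multiple of [p], so the result is independent of the choice, and additivity and
    multiplicativity follow. *)
Lemma exists_embedding (F : fieldType) (p : {poly rat}) t (z : F)
    (psi : {rmorphism rat -> F}) :
  irreducible_poly p -> root (map_poly (in_alg K) p) t ->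
  <<1; t>>%VS = {:K}%VS -> root (map_poly psi p) z ->
  exists sigma : {rmorphism K -> F}, sigma t = z.
Proof.
move=> p_irr pt gen_t pz.
have /choice [P PE] := generator_horner gen_t.
have well q1 q2 : (map_poly (in_alg K) q1).[t] = (map_poly (in_alg K) q2).[t] ->
    (map_poly psi q1).[z] = (map_poly psi q2).[z].
  move=> /eqP; rewrite -subr_eq0 -hornerN -hornerD -rmorphN -rmorphD => E.
  have /dvdpP [s sE] := irreducible_dvdp_root p_irr pt E.
  apply/eqP; rewrite -subr_eq0 -hornerN -hornerD -rmorphN -rmorphD /= sE.
  by rewrite rmorphM hornerM (rootP pz) mulr0.
pose f x := (map_poly psi (P x)).[z].
have fB : zmod_morphism f.
  move=> x y; rewrite /f -hornerN -hornerD -rmorphN -rmorphD; apply: well.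
  by rewrite rmorphD rmorphN hornerD hornerN -!PE.
have fM : monoid_morphism f.
  split=> [|x y].
    have -> : 1 = (map_poly psi 1).[z] by rewrite rmorph1 hornerC.
    by apply: well; rewrite -PE rmorph1 hornerC.
  rewrite /f -hornerM -rmorphM; apply: well.
  by rewrite rmorphM hornerM -!PE.
pose fA := GRing.isZmodMorphism.Build K F f fB.
pose fR := GRing.isMonoidMorphism.Build K F f fM.
exists (HB.pack f fA fR : {rmorphism K -> F}); rewrite /= /f.
rewrite -[z in RHS]hornerX -(map_polyX psi); apply: well.
by rewrite -PE map_polyX hornerX.
Qed.
End RationalExtension.

(** * Pisot generators and their differences *)

Section RealNumberField.
Variables (R : realType) (K : fieldExtType rat) (iota : {rmorphism K -> R}).
Let phi : {rmorphism K -> R[i]} := real_complex R \o iota.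

(* If [t] were not in [Q(y)], its minimal polynomial over [Q(y)] would have another
   complex root [z]; it divides [h - y], so [h z = iota y > 1]. *)
Lemma small_conjugates_generate (p h : {poly rat}) (t y : K) :
  irreducible_poly p -> root (map_poly (in_alg K) p) t ->
  <<1; t>>%VS = {:K}%VS -> y = (map_poly (in_alg K) h).[t] -> 1 < iota y ->
  (forall z : R[i], root (map_poly ratr p) z -> z != phi t ->
     `|(map_poly ratr h).[z]| < 1) ->
  <<1; y>>%VS = {:K}%VS.
Proof.
move=> p_irr pt gen_t yE y_gt1 h_small.
apply/eqP; rewrite eqEsubv subvf -gen_t; apply/FadjoinP.
split; first exact: subv_adjoin.
case: (boolP (t \in <<1; y>>%VS)) => [//|t_notin].
pose m := minPoly <<1; y>> t; pose M := map_poly phi m.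
have algOver (q : {poly rat}) : map_poly (in_alg K) q \is a polyOver <<1; y>>%VS.
  have : map_poly (in_alg K) q \is a polyOver 1%VS by apply/polyOver1P; exists q.
  by apply: polyOverS; apply: subvP; exact: subv_adjoin.
have phi_map (q : {poly rat}) :
    map_poly phi (map_poly (in_alg K) q) = map_poly ratr q.
  rewrite -map_poly_comp; apply: eq_map_poly => a.
  exact: (fmorph_eq_rat (phi \o in_alg K)).
have Mp : M %| map_poly ratr p.
  by rewrite -phi_map dvdp_map; apply: minPoly_dvdp; rewrite ?algOver.
have Mh : M %| map_poly ratr h - (phi y)%:P.
  have -> : map_poly ratr h - (phi y)%:P =
      map_poly phi (map_poly (in_alg K) h - y%:P).
    by rewrite rmorphB /= phi_map map_polyC.
  rewrite dvdp_map; apply: minPoly_dvdp.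
    by rewrite rpredB ?algOver // polyOverC memv_adjoin.
  by rewrite /root hornerD hornerN hornerC -yE subrr.
have M_sep : separable_poly M.
  apply: dvdp_separable Mp _; rewrite separable_map.
  exact: irreducible_poly_separable.
have [N MN] : exists N, M = N * ('X - (phi t)%:P).
  by apply/factor_theorem; rewrite fmorph_root root_minPoly.
have M_gt2 : (2 < size M)%N.
  rewrite size_map_poly size_minPoly ltnS ltn_neqAle eq_sym.
  by rewrite adjoin_deg_eq1 t_notin adjoin_degreeE divn_gt0 ?adim_gt0 // dimvS //
    subv_adjoin.
have [z Nz] : exists z, root N z.
  apply/closed_rootP; apply: contraTneq M_gt2 => szN.
  by rewrite -leqNgt MN (leq_trans (size_polyMleq _ _)) // szN size_XsubC.
have Mz : root M z by rewrite MN rootM Nz.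
(* Separability makes [phi t] a simple root of [M], hence not a root of [N]. *)
have z_neq : z != phi t.
  move: M_sep; rewrite MN separable_root => /andP [_].
  by apply: contraNneq => <-.
have := h_small z (root_dvdp Mp Mz) z_neq.
have /rootP := root_dvdp Mh Mz.
rewrite hornerD hornerN hornerC => /eqP; rewrite subr_eq0 => /eqP ->.
rewrite /phi /= normc_real -[1]/(1%:C) ltcR ltNge (le_trans (ltW y_gt1)) //.
exact: ler_norm.
Qed.

(* As [y] generates [K], [t = l y] for a rational polynomial [l]; a conjugate [w] of
   [y] is then [h (l w)], and [l w] is a conjugate of [t]. *)
Lemma small_conjugates_pisot (p h : {poly rat}) (t y : K) :
  irreducible_poly p -> root (map_poly (in_alg K) p) t ->
  <<1; t>>%VS = {:K}%VS -> y = (map_poly (in_alg K) h).[t] ->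
  integralOver (intr : int -> K) y -> 1 < iota y ->
  (forall z : R[i], root (map_poly ratr p) z -> z != phi t ->
     `|(map_poly ratr h).[z]| < 1) ->
  pisot_generators iota (iota y).
Proof.
move=> p_irr pt gen_t yE y_int y_gt1 h_small.
have gen_y := small_conjugates_generate p_irr pt gen_t yE y_gt1 h_small.
exists y => //; split=> //; split=> //.
  case: (integral_rmorph iota y_int) => q q_monic qy; exists q => //.
  by rewrite -(eq_map_poly (rmorph_int iota)).
move=> w [q [_ q_irr qy qw]] w_neq.
have [l tE] := generator_horner gen_y t.
have conj_root (s : {poly rat}) :
    (map_poly (in_alg K) s).[y] = 0 -> (map_poly (@ratr R[i]) s).[w] = 0.
  move=> sy; have sR : root (map_poly ratr s) (iota y).
    by rewrite /root -fmorph_horner_alg sy rmorph0.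
  apply/rootP; apply: root_dvdp qw; rewrite dvdp_map.
  exact: irreducible_dvdp_root q_irr qy sR.
pose z := (map_poly (@ratr R[i]) l).[w].
(* The polynomial h(l(X)) - X vanishes at [y], hence at its conjugate [w]. *)
have hz : (map_poly ratr h).[z] = w.
  have := conj_root (h \Po l - 'X); rewrite !rmorphB /= !map_comp_poly !map_polyX.
  rewrite !hornerD !hornerN !hornerX !horner_comp -tE -yE subrr -/z.
  by move=> /(_ erefl) /eqP; rewrite subr_eq0 => /eqP.
rewrite -hz; apply: h_small.
  have := conj_root (p \Po l); rewrite !map_comp_poly !horner_comp -tE.
  by move/(_ (rootP pt))/rootP.
apply: contraNneq w_neq => zt.
by rewrite -hz zt -fmorph_horner_alg -yE.
Qed.

(** [sigma t] is a conjugate of [iota t]; were they equal, [sigma] would be the inclusion because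
    [t] generates [K]. *)
Lemma pisot_generator_embedding (t : K) (sigma : {rmorphism K -> R[i]}) :
  pisot (iota t) -> <<1; t>>%VS = {:K}%VS ->
  ~ (sigma =1 fun x => (iota x)%:C) -> `|sigma t| < 1.
Proof.
move=> [_ _ small] gen_t sigma_neq.
have [p [p_monic p_irr pt]] := exists_rat_minPoly t.
apply: small; last first.
  apply/eqP => st; apply: sigma_neq => x.
  have [q ->] := generator_horner gen_t x.
  rewrite fmorph_horner_alg st -[RHS]/(phi _) fmorph_horner_alg //.
exists p; split=> //; rewrite /root -fmorph_horner_alg (rootP pt) rmorph0 //.
Qed.

Lemma pisot_differences_small :
  (pisot_differences iota `<=` small_conjugate_integers iota)%classic.
Proof.
move=> b [b_gt0 [x [y [[t [t_pisot gen_t] <-] [u [u_pisot gen_u] <-]]]]] bE.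
have int_pisot v : pisot (iota v) -> integralOver (intr : int -> K) v.
  move=> [[q q_monic qv] _ _]; exists q => //.
  rewrite -(fmorph_root iota) -map_poly_comp.
  by rewrite (eq_map_poly (rmorph_int iota)).
exists (t - u); last by rewrite rmorphB.
split; first by apply: integral_sub; apply: int_pisot.
  by rewrite rmorphB -bE.
move=> sigma sigma_neq; rewrite rmorphB.
apply: le_lt_trans (ler_normB _ _) _; rewrite -[2]/(1 + 1).
by apply: ltrD; apply: pisot_generator_embedding.
Qed.

(** Finitely many strict inequalities share a positive margin, which leaves room for a uniform
    approximation error. *)
Lemma strict_bound_margin (I : eqType) (s : seq I) (P : I -> bool) (f : I -> R)
    (c : R) : {in s, forall i, P i -> f i < c} ->
  exists2 e, 0 < e & {in s, forall i, P i -> f i + e <= c}.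
Proof.
elim: s => [|i s IHs] fs; first by exists 1.
have [|e e_gt0 es] := IHs; first by move=> j js; apply: fs; rewrite inE js orbT.
case Pi : (P i); last first.
  by exists e => // j /predU1P [->|/es //]; rewrite Pi.
have fi : 0 < c - f i by rewrite subr_gt0 fs ?mem_head.
exists (Num.min e (c - f i)); first by rewrite lt_min e_gt0.
move=> j /predU1P [-> _|js Pj].
  by rewrite -lerBrDl ge_min lexx orbT.
by apply: le_trans (es j js Pj); rewrite lerD2l ge_min lexx.
Qed.

Lemma small_conjugate_differences :
  (small_conjugate_integers iota `<=` pisot_differences iota)%classic.
Proof.
move=> _ [b [b_int b_gt0 b_small] <-].
have [t t_int gen_t] := exists_integral_generator K.
have [p [p_monic p_irr pt]] := exists_rat_minPoly t.
have [g bE] := generator_horner gen_t b.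
have pt_R : root (map_poly ratr p) (iota t).
  by rewrite /root -fmorph_horner_alg (rootP pt) rmorph0.
pose v z := Normc.normc (map_poly (@ratr R[i]) g).[z].
have v_small z : root (map_poly ratr p) z -> z != phi t -> v z < 2.
  move=> pz z_neq.
  (* The root [z] is the image of [t] under an embedding other than the inclusion, so g(z) is the
     image of [b] there. *)
  have [sigma st] := exists_embedding p_irr pt gen_t pz.
  have := b_small sigma; rewrite bE fmorph_horner_alg st.
  rewrite -[`|_|]/((v z)%:C) -[2]/(2%:R) -(rmorph_nat (real_complex R)) ltcR.
  apply=> E; case/eqP: z_neq; rewrite -st; exact: E.
have [rs prs] := closed_field_poly_normal (map_poly (@ratr R[i]) p).
have rsP z : (z \in rs) = root (map_poly ratr p) z.
  rewrite prs rootZ ?root_prod_XsubC //.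
  by rewrite lead_coef_eq0 map_poly_eq0 monic_neq0.
have [|e e_gt0 es] := @strict_bound_margin _ rs (fun z => z != phi t) v 2.
  by move=> z; rewrite rsP; apply: v_small.
(* The margin gives |g(z)/2| <= 1 - e/2. If h + g/2 is at most e/4 at [z], then h and h + g, which
   differ from it by g/2, are at most 1 - e/4. *)
have e4_gt0 : 0 < e / 4 by rewrite divr_gt0.
have [h [h_gt1 h_approx]] :=
  integer_poly_approximation p_monic p_irr pt_R (- (2^-1 *: g)) 1 e4_gt0.
pose hQ : {poly rat} := map_poly intr h.
pose y := (map_poly (in_alg K) hQ).[t].
have hQ_map (F : numFieldType) : map_poly (@ratr F) hQ = map_poly intr h.
  by rewrite -map_poly_comp; apply: eq_map_poly => x; rewrite /= ratr_int.
have y_int : integralOver (intr : int -> K) y.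
  have -> : y = (map_poly intr h).[t].
    rewrite /y -map_poly_comp; congr _.[_]; apply: eq_map_poly => x.
    by rewrite -(rmorph_int (in_alg K)).
  apply: integral_horner t_int; apply/integral_poly => i.
  by rewrite coef_map; apply: integral_id.
have y_gt1 : 1 < iota y by rewrite fmorph_horner_alg hQ_map.
have key z : root (map_poly ratr p) z -> z != phi t ->
    `|(map_poly ratr hQ).[z]| < 1 /\ `|(map_poly ratr (hQ + g)).[z]| < 1.
  move=> pz z_neq.
  have := h_approx z pz z_neq; rewrite -hQ_map !rmorphN rmorphD /= map_polyZ.
  rewrite hornerD hornerN hornerZ opprK.
  have : `|(map_poly ratr g).[z]| <= (2 - e)%:C.
    rewrite -[`|_|]/((v z)%:C) lecR; have := es z; rewrite rsP => /(_ pz z_neq); lra.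
  move: (map_poly ratr hQ).[z] (map_poly ratr g).[z] => H G G_le.
  rewrite rmorphV ?unitfE // rmorph_nat => HG_le.
  have G2_le : `|2^-1 * G| <= (1 - e / 2)%:C.
    have -> : (1 - e / 2)%:C = 2^-1 * (2 - e)%:C.
      by rewrite -(rmorph_nat (real_complex R)) -fmorphV -rmorphM /=; congr (_%:C); field.
    by rewrite normrM ger0_norm ?ler_wpM2l ?invr_ge0.
  have lt1 : (e / 4)%:C + (1 - e / 2)%:C < 1.
    by rewrite -rmorphD -[ltRHS]/(1%:C) ltcR; lra.
  split; apply: le_lt_trans lt1.
    have -> : H = (H + 2^-1 * G) - 2^-1 * G by rewrite addrK.
    by apply: le_trans (ler_normB _ _) (lerD _ _).
  have -> : H + G = (H + 2^-1 * G) + 2^-1 * G.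
    by rewrite -addrA -mulrDl -[2^-1]mul1r -splitr mul1r.
  by apply: le_trans (ler_normD _ _) (lerD _ _).
rewrite /pisot_differences /=; split=> //; exists (iota (y + b)), (iota y); split.
- apply: (small_conjugates_pisot (h := hQ + g) p_irr pt gen_t).
  + by rewrite rmorphD hornerD -bE.
  + exact: integral_add.
  + by rewrite rmorphD ltr_wpDr // ltW.
  + by move=> z pz z_neq; case: (key z pz z_neq).
- apply: (small_conjugates_pisot (h := hQ) p_irr pt gen_t) => //.
  by move=> z pz z_neq; case: (key z pz z_neq).
- by rewrite -rmorphB addrC addKr.
Qed.
End RealNumberField.

Theorem corollary1 (R : realType) (K : fieldExtType rat)
    (iota : {rmorphism K -> R}) :
  small_conjugate_integers iota = pisot_differences iota.
Proof.
apply/seteqP; split.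
  exact: small_conjugate_differences.
exact: pisot_differences_small.
Qed.
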